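(* If $G$ is a non-complete, double-critical, $t$-chromatic graph with $t \ge 6$, then no vertex of degree $t + 1$ is adjacent to a vertex of degree $t + 1$, $t + 2$, or $t + 3$ in $G$.
   Context: All graphs are finite, without loops or multiple edges. $\chi(G)$ denotes the chromatic number of $G$; $G$ is $t$-chromatic if $\chi(G) = t$. For $A \subseteq V(G)$, $G \setminus A$ is the subgraph of $G$ induced on $V(G) \setminus A$. A connected graph $G$ is double-critical if for every edge $xy \in E(G)$, $\chi(G \setminus \{x, y\}) = \chi(G) - 2$. ''Non-complete'' means not a complete graph. *)

(* Defs.v *)
From mathcomp Require Import all_boot.

Set Implicit Arguments.
Unset Strict Implicit.
Unset Printing Implicit Defensive.

Record sgraph := SGraph {
  vertex :> finType;
  adj : rel vertex;
  adj_sym : symmetric adj;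
  adj_irrefl : irreflexive adj }.

Section Graph.
Variable G : sgraph.
Implicit Types (x y : G) (A : {set G}).

Definition deg x : nat := #|[set y | adj x y]|.

Definition connected : Prop := forall x y, connect (@adj G) x y.

Definition complete : Prop := forall x y, x != y -> adj x y.

Definition proper_coloring k (f : {ffun G -> 'I_k}) : bool :=
  [forall x, forall y, adj x y ==> (f x != f y)].

Definition colorable k : bool := [exists f : {ffun G -> 'I_k}, proper_coloring f].

Lemma colorable_ex : exists k, colorable k.
Proof.
exists #|G|; apply/existsP; exists [ffun x => enum_rank x].
apply/forallP=> x; apply/forallP=> y; apply/implyP=> xy; rewrite !ffunE.
by apply: contraTneq xy => /enum_rank_inj->; rewrite adj_irrefl.
Qed.

Definition chi : nat := ex_minn colorable_ex.

Section Induced.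
Variable A : {set G}.

Definition induced_adj : rel {x : G | x \in A} := fun u v => adj (val u) (val v).

Lemma induced_adj_sym : symmetric induced_adj.
Proof. by move=> u v; apply: adj_sym. Qed.

Lemma induced_adj_irrefl : irreflexive induced_adj.
Proof. by move=> u; apply: adj_irrefl. Qed.

Definition induced : sgraph := SGraph induced_adj_sym induced_adj_irrefl.

End Induced.

Definition remove A : sgraph := induced (~: A).

End Graph.

(* The truncated subtraction is harmless: a graph with an edge has chi >= 2. *)
Definition double_critical (G : sgraph) : Prop :=
  connected G /\
  forall x y : G, adj x y -> chi (remove [set x; y]) = chi G - 2.

(* Main.v *)
Require Import Defs.
From mathcomp Require Import all_boot zify.

(** Let x have degree t+1 and let H be the complement of G[N(x)]. Colour G - x - y with t-2
    colours, for an edge xy. Kempe-type recolourings show that x and y have a common neighbour of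
    every colour, and that for any two colours i and j there is a path x, z, w, y with z coloured i
    and w coloured j. The first fact makes H a disjoint union of isolated vertices and cycles of
    length at least five, and a further count shows that the cycles have at least eight vertices
    altogether. Then N(x) - y contains many vertices v whose colour is not repeated among the
    common neighbours of x and y, and which have an H-neighbour w whose colour is not repeated in
    N(x) - y; the path whose colours are those of w and v must end in a neighbour of y outside
    N[x] coloured like v. When y lies on a cycle of H it has t-2 common neighbours with x, and
    there are at least five such v; when y is isolated in H there are t common neighbours and at
    least three such v. Either way y has degree at least t+4. *)

Set Implicit Arguments.
Unset Strict Implicit.
Unset Printing Implicit Defensive.

(** * Counting the elements whose value is repeated *)

Section SharedValues.
Variables (T : finType) (f : T -> nat) (B : {set T}) (k : nat).
Hypothesis fB : {in B, forall b, f b < k}.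

Definition shared := [set b in B | [exists b' in B, (b' != b) && (f b' == f b)]].

Lemma shared_sub : shared \subset B.
Proof. by apply/subsetP => b; rewrite inE => /andP[]. Qed.

Lemma sharedP b :
  reflect (b \in B /\ exists2 b', b' \in B & b' != b /\ f b' = f b) (b \in shared).
Proof.
rewrite inE; apply: (iffP andP) => [[bB /existsP[b' /and3P[h1 h2 /eqP h3]]]|].
  by split=> //; exists b'.
by case=> bB [b' h1 [h2 /eqP h3]]; split=> //; apply/existsP; exists b'; apply/and3P.
Qed.

Lemma notin_shared b b' : b \in B -> b' \in B -> b \notin shared -> f b' = f b -> b' = b.
Proof.
move=> bB b'B nb e; apply/eqP/negPn/negP => ne; case/negP: nb; apply/sharedP.
by split=> //; exists b'.
Qed.

Definition fibre i := [set b in B | f b == i].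

Lemma card_fibres (A : {set T}) : A \subset B -> #|A| = \sum_(i < k) #|A :&: fibre i|.
Proof.
move=> AB.
rewrite -sum1_card (eq_bigr (fun b => \sum_(i < k) (f b == i))); last first.
  move=> b bA; have fb := fB (subsetP AB _ bA).
  rewrite (bigD1 (Ordinal fb)) //= eqxx big1 // => i ni.
  by apply/eqP; rewrite eqb0; apply: contraNneq ni => e; apply/eqP/val_inj.
rewrite exchange_big /=; apply: eq_bigr => i _.
rewrite -sum1_card big_mkcond [RHS]big_mkcond; apply: eq_bigr => b _.
rewrite !inE; case bA: (b \in A) => //=; rewrite (subsetP AB) //=.
Qed.

(** Fibre by fibre: a fibre F of size at most one has 2|F| at most 2, and a fibre of size two is
    wholly shared, so that 4 = 2 + 2. *)
Lemma shared_geq :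
  (forall u v w, u \in B -> v \in B -> w \in B -> f u = f v -> f v = f w ->
     [\/ u = v, v = w | u = w]) ->
  #|B| * 2 <= k * 2 + #|shared|.
Proof.
move=> f3; rewrite (card_fibres (subxx B)) (card_fibres shared_sub).
rewrite big_distrl /= -[k in k * 2]card_ord -sum_nat_const -big_split /=.
apply: leq_sum => i _.
have -> : B :&: fibre i = fibre i by apply/setIidPr/subsetP => b; rewrite inE => /andP[].
have [le1|gt1] := leqP #|fibre i| 1; first lia.
have le2 : #|fibre i| <= 2.
  rewrite leqNgt; apply/negP => /card_gt2P [u [v [w [[hu hv hw] [uv vw wu]]]]].
  move: hu hv hw; rewrite !inE => /andP[uB /eqP eu] /andP[vB /eqP ev] /andP[wB /eqP ew].
  have [] := f3 u v w uB vB wB; rewrite ?eu ?ev ?ew // => e.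
  - by rewrite e eqxx in uv.
  - by rewrite e eqxx in vw.
  - by rewrite e eqxx in wu.
suff -> : shared :&: fibre i = fibre i by lia.
apply/setIidPr/subsetP => b bi; apply/sharedP.
move: (bi); rewrite inE => /andP[bB /eqP fb]; split=> //.
move: gt1; rewrite (cardsD1 b) bi ltnS => /card_gt0P[b'].
by rewrite !inE => /and3P[ne b'B /eqP e]; exists b'; rewrite // fb e.
Qed.

(** Fibre by fibre: a singleton fibre contributes nothing shared and gives equality, while a fibre
    of size n at least two gives 2 + n, at most 2n. *)
Lemma shared_leq :
  (forall i, i < k -> exists2 b, b \in B & f b = i) -> k * 2 + #|shared| <= #|B| * 2.
Proof.
move=> fK; rewrite (card_fibres (subxx B)) (card_fibres shared_sub).
rewrite big_distrl /= -[k in k * 2]card_ord -sum_nat_const -big_split /=.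
apply: leq_sum => i _.
have -> : B :&: fibre i = fibre i by apply/setIidPr/subsetP => b; rewrite inE => /andP[].
have [b bB fb] := fK i (ltn_ord i).
have bi : b \in fibre i by rewrite inE bB fb eqxx.
have le : #|shared :&: fibre i| <= #|fibre i| by rewrite subset_leq_card ?subsetIr.
have [gt1|le1] := ltnP 1 #|fibre i|; first lia.
suff -> : shared :&: fibre i = set0.
  have : 0 < #|fibre i| by apply/card_gt0P; exists b.
  by rewrite cards0; lia.
apply/setP => u; rewrite in_set0 in_setI; apply/negP => /andP[/sharedP[uB [v vB [vu fv]]] ui].
move: (ui); rewrite inE uB /= => /eqP fu.
have vi : v \in fibre i by rewrite inE vB fv fu eqxx.
by have /card_le1_eqP h := le1; rewrite (h v u vi ui) eqxx in vu.
Qed.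

End SharedValues.

(** * Disjoint unions of isolated vertices and cycles of length at least five *)

Section GirthFive.
Variables (T : finType) (H : rel T).
Hypothesis H_sym : symmetric H.
Hypothesis H_irr : irreflexive H.
Hypothesis H_other : forall u v, H v u ->
  exists2 w, w != u & forall z, H v z = (z == u) || (z == w).
Hypothesis H_C3 : forall a b c, H a b -> H b c -> ~~ H a c.
Hypothesis H_C4 : forall a b c d, H a b -> H b c -> H c d -> H d a -> a = c \/ b = d.

Definition nonisolated := [set v | [exists u, H v u]].

Lemma nonisolatedP v : reflect (exists u, H v u) (v \in nonisolated).
Proof. by rewrite inE; apply: existsP. Qed.

Lemma two_neighbours u v w :
  H u v -> H u w -> v != w -> forall z, H u z -> z = v \/ z = w.
Proof.
move=> uv uw vw z uz; have [d dv Nu] := H_other uv.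
move: uw uz; rewrite !Nu eq_sym (negPf vw) /= => /eqP-> /orP[] /eqP; by [left|right].
Qed.

Lemma rel_neq u v : H u v -> u != v.
Proof. by apply: contraTneq => ->; rewrite H_irr. Qed.

Lemma leq_card_uniq (s : seq T) (K : {set T}) :
  uniq s -> {subset s <= K} -> size s <= #|K|.
Proof. by move/card_uniqP <- => sK; apply/subset_leq_card/subsetP. Qed.

(** A vertex, its two neighbours and their two further neighbours are distinct, since there is no
    triangle and no 4-cycle. *)
Lemma closed_geq5 (K : {set T}) v :
  v \in K -> K \subset nonisolated -> (forall a b, a \in K -> H a b -> b \in K) -> 5 <= #|K|.
Proof.
move=> vK /subsetP KS Kcl.
have /nonisolatedP[u1 vu1] := KS v vK.
have [u2 u21 Nv] := H_other vu1.
have vu2 : H v u2 by rewrite Nv eqxx orbT.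
have [w1 w1v Nu1] : exists2 w, w != v & forall z, H u1 z = (z == v) || (z == w).
  by apply: H_other; rewrite H_sym.
have [w2 w2v Nu2] : exists2 w, w != v & forall z, H u2 z = (z == v) || (z == w).
  by apply: H_other; rewrite H_sym.
have u1w1 : H u1 w1 by rewrite Nu1 eqxx orbT.
have u2w2 : H u2 w2 by rewrite Nu2 eqxx orbT.
have w1u2 : w1 != u2 by apply: contraTneq vu2 => <-; apply: H_C3 u1w1.
have w2u1 : w2 != u1 by apply: contraTneq vu1 => <-; apply: H_C3 u2w2.
have w12 : w1 != w2.
  apply/eqP => e; rewrite -e in u2w2.
  have [] := H_C4 vu1 u1w1 (etrans (H_sym _ _) u2w2) (etrans (H_sym _ _) vu2).
  - by move=> e'; rewrite e' eqxx in w1v.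
  - by move=> e'; rewrite e' eqxx in u21.
have u1K := Kcl _ _ vK vu1; have u2K := Kcl _ _ vK vu2.
have w1K := Kcl _ _ u1K u1w1; have w2K := Kcl _ _ u2K u2w2.
apply: (@leq_card_uniq [:: v; u1; u2; w1; w2]).
  rewrite /= !inE !negb_or (rel_neq vu1) (rel_neq vu2) (rel_neq u1w1) (rel_neq u2w2) w12.
  by rewrite (eq_sym u1) u21 !(eq_sym v) w1v w2v (eq_sym u1) w2u1 (eq_sym u2) w1u2.
by move=> z; rewrite !inE => /or4P[|||/orP[]] /eqP->.
Qed.

Lemma co_closed_geq5 (K : {set T}) :
  (forall a b, a \in K -> H a b -> b \in K) -> #|K| < #|nonisolated| ->
  (forall a b, a \in nonisolated :\: K -> H a b -> b \in nonisolated :\: K) /\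
  5 <= #|nonisolated :\: K|.
Proof.
move=> Kcl ltK.
have cl a b : a \in nonisolated :\: K -> H a b -> b \in nonisolated :\: K.
  rewrite !in_setD => /andP[aK _] ab; have ba : H b a by rewrite H_sym.
  rewrite (contra (fun bK => Kcl _ _ bK ba) aK); apply/nonisolatedP; by exists a.
split=> //.
have /card_gt0P[v vK] : 0 < #|nonisolated :\: K|.
  rewrite cardsD subn_gt0; apply: leq_ltn_trans ltK.
  by rewrite subset_leq_card ?subsetIr.
by apply: closed_geq5 vK (subsetDl _ _) cl.
Qed.

(** At least four nonisolated vertices lie off P, so one bad vertex, with all its neighbours in P,
    does no harm. Two bad vertices close up with P to a hexagon; the remaining cycles then avoid P
    and have at least five vertices. *)
Lemma nonisolated_neighbour_off (P : {set T}) : #|P| <= 4 ->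
  (forall p, p \in P -> exists2 p', p' \in P & H p p') -> 8 <= #|nonisolated| ->
  3 <= #|[set v in nonisolated :\: P | [exists w, H v w && (w \notin P)]]|.
Proof.
move=> P4 Pp S8; set good := [set v in _ | _].
have PS : P \subset nonisolated.
  by apply/subsetP => p /Pp[p' _ pp']; apply/nonisolatedP; exists p'.
set bad := (nonisolated :\: P) :\: good.
have badP b : b \in bad -> [/\ b \in nonisolated, b \notin P & forall w, H b w -> w \in P].
  rewrite !inE => /andP[h /andP[bP bS]]; rewrite bP bS /= in h; split=> //.
  by move=> w bw; apply: contraNT h => wP; apply/existsP; exists w; rewrite bw.
have sum : #|nonisolated :\: P| = #|good| + #|bad|.
  have gS : good \subset nonisolated :\: P by apply/subsetP => v; rewrite inE => /andP[].
  by rewrite -(cardsID good) (setIidPr gS).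
have SP : 4 <= #|nonisolated :\: P|.
  by rewrite cardsD (setIidPr PS); lia.
have [le1|gt1] := leqP #|bad| 1; first by lia.
have /card_gt1P[b1 [b2 [/badP[b1S b1P Nb1] /badP[b2S b2P Nb2] b12]]] := gt1.
have /nonisolatedP[p b1p] := b1S.
have [q qp Nb1'] := H_other b1p.
have b1q : H b1 q by rewrite Nb1' eqxx orbT.
have pP := Nb1 _ b1p; have qP := Nb1 _ b1q.
have [p' p'P pp'] := Pp _ pP; have [q' q'P qq'] := Pp _ qP.
have p'q : p' != q by apply: contraTneq b1q => <-; apply: H_C3 pp'.
have q'p : q' != p by apply: contraTneq b1p => <-; apply: H_C3 qq'.
have p'q' : p' != q'.
  apply/eqP => e; rewrite -e in qq'.
  have [] := H_C4 b1p pp' (etrans (H_sym _ _) qq') (etrans (H_sym _ _) b1q).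
  - by move=> e'; rewrite e' p'P in b1P.
  - by move=> e'; rewrite e' eqxx in qp.
(* P consists of two disjoint edges pp' and qq', with b1 joined to p and q. *)
have PE z : z \in P -> [\/ z = p, z = p', z = q | z = q'].
  move=> zP; have [->|zp] := eqVneq z p; first by constructor 1.
  have [->|zp'] := eqVneq z p'; first by constructor 2.
  have [->|zq] := eqVneq z q; first by constructor 3.
  have [->|zq'] := eqVneq z q'; first by constructor 4.
  suff : 5 <= #|P| by rewrite ltnNge P4.
  apply: (@leq_card_uniq [:: z; p; p'; q; q']).
    rewrite /= !inE !negb_or zp zp' zq zq' (rel_neq pp') (rel_neq qq') p'q p'q'.
    by rewrite !(eq_sym p) qp q'p.
  by move=> ?; rewrite !inE => /or4P[|||/orP[]] /eqP->.
have p'b1 : p' != b1 by apply: contraNneq b1P => <-.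
have q'b1 : q' != b1 by apply: contraNneq b1P => <-.
have Np := two_neighbours pp' (etrans (H_sym _ _) b1p) p'b1.
have Nq := two_neighbours qq' (etrans (H_sym _ _) b1q) q'b1.
have nb2p : ~~ H b2 p.
  rewrite H_sym; apply/negP => /Np[] e; first by rewrite e p'P in b2P.
  by rewrite e eqxx in b12.
have nb2q : ~~ H b2 q.
  rewrite H_sym; apply/negP => /Nq[] e; first by rewrite e q'P in b2P.
  by rewrite e eqxx in b12.
have Nb2' z : H b2 z -> z = p' \/ z = q'.
  move=> bz; case: (PE _ (Nb2 _ bz)) => e; try by [left|right].
  - by rewrite e (negPf nb2p) in bz.
  - by rewrite e (negPf nb2q) in bz.
have [b2p' b2q'] : H b2 p' /\ H b2 q'.
  have /nonisolatedP[u b2u] := b2S; have [w wu N] := H_other b2u.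
  have b2w : H b2 w by rewrite N eqxx orbT.
  case: (Nb2' _ b2u) (Nb2' _ b2w) => e [] e'; subst; rewrite ?b2u ?b2w //.
    by rewrite eqxx in wu.
  by rewrite eqxx in wu.
have pb2 : p != b2 by apply: contraNneq b2P => <-.
have qb2 : q != b2 by apply: contraNneq b2P => <-.
have Np' := two_neighbours (etrans (H_sym _ _) pp') (etrans (H_sym _ _) b2p') pb2.
have Nq' := two_neighbours (etrans (H_sym _ _) qq') (etrans (H_sym _ _) b2q') qb2.
(* This is the 6-cycle b1, p, p', b2, q', q. *)
pose K := b1 |: (b2 |: P).
have Kcl a b : a \in K -> H a b -> b \in K.
  rewrite /K !inE => /or3P[/eqP->|/eqP->|aP].
  - by move/Nb1->; rewrite !orbT.
  - by move/Nb2->; rewrite !orbT.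
  by case: (PE _ aP) => -> h; [case: (Np _ h)|case: (Np' _ h)|case: (Nq _ h)|case: (Nq' _ h)]
    => ->; rewrite ?eqxx ?p'P ?q'P ?pP ?qP ?orbT.
have ltK : #|K| < #|nonisolated|.
  apply: leq_trans S8; rewrite /K !cardsU1 ltnS.
  by apply: (@leq_trans (1 + (1 + 4))); rewrite // !leq_add ?leq_b1.
have [cl D5] := co_closed_geq5 Kcl ltK.
apply: leq_trans (ltnW (ltnW D5)) _.
apply/subset_leq_card/subsetP => v vD; rewrite inE.
have nP z : z \in nonisolated :\: K -> z \notin P.
  by rewrite /K !inE !negb_or => /andP[/and3P[]].
apply/andP; split; first by rewrite in_setD nP //; case/setDP: vD.
have /nonisolatedP[w vw] : v \in nonisolated by case/setDP: vD.
by apply/existsP; exists w; rewrite vw nP // (cl v).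
Qed.

(** The path a', a, y, b, b' lies on one cycle. If that cycle has length five or six, the vertices
    of the other cycles suffice; if it is longer, every nonisolated vertex off {y, a, b} qualifies,
    and there are at least 8 - 3 of them. *)
Lemma nonisolated_neighbour_off_path y a b a' b' :
  H y a -> H y b -> a != b -> H a a' -> a' != y -> H b b' -> b' != y ->
  8 <= #|nonisolated| ->
  5 <= #|[set v in nonisolated :\: [set y; a; b] |
          [exists w, H v w && (w \notin [set y; a; b; a'; b'])]]|.
Proof.
move=> ya yb ab aa' a'y bb' b'y S8; set good := [set v in _ | _].
have Hs u v : H u v -> H v u by rewrite H_sym.
have Ny := two_neighbours ya yb ab.
have Na := two_neighbours aa' (Hs _ _ ya) a'y.
have Nb := two_neighbours bb' (Hs _ _ yb) b'y.
have a'b : a' != b by apply: contraTneq yb => <-; apply: H_C3 aa'.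
have b'a : b' != a by apply: contraTneq ya => <-; apply: H_C3 bb'.
have a'b' : a' != b'.
  apply/eqP => e; rewrite -e in bb'.
  have [] := H_C4 ya aa' (Hs _ _ bb') (Hs _ _ yb) => e'.
  - by rewrite e' eqxx in a'y.
  - by rewrite e' eqxx in ab.
have remnant (K : {set T}) : [set y; a; b; a'; b'] \subset K -> #|K| < 8 ->
    (forall u v, u \in K -> H u v -> v \in K) -> 5 <= #|good|.
  move=> /subsetP sK K8 Kcl; have [cl D5] := co_closed_geq5 Kcl (leq_trans K8 S8).
  apply: leq_trans D5 _; apply/subset_leq_card/subsetP => v vD.
  have nK z : z \in nonisolated :\: K -> z \notin [set y; a; b; a'; b'].
    by case/setDP=> _; apply: contra => /sK.
  have /nonisolatedP[w vw] : v \in nonisolated by case/setDP: vD.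
  rewrite inE; apply/andP; split.
    rewrite in_setD (contra _ (nK _ vD)); first by case/setDP: vD.
    by rewrite !inE => ->.
  by apply/existsP; exists w; rewrite vw nK // (cl v).
have cardK (s : seq T) : size s < 8 -> #|[set z in s]| < 8.
  by apply: leq_ltn_trans; rewrite cardsE; apply: card_size.
have [a2 a2a Na'] := H_other (Hs _ _ aa').
have [b2 b2b Nb'] := H_other (Hs _ _ bb').
have a'a2 : H a' a2 by rewrite Na' eqxx orbT.
have b'b2 : H b' b2 by rewrite Nb' eqxx orbT.
have a2K z : H a' z -> z = a \/ z = a2 by rewrite Na' => /orP[] /eqP; by [left|right].
have b2K z : H b' z -> z = b \/ z = b2 by rewrite Nb' => /orP[] /eqP; by [left|right].
(* The cycle through y is a pentagon. *)
have [e|a2b'] := eqVneq a2 b'.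
  have e2 : b2 = a'.
    by case: (b2K a'); rewrite ?[H b' _]H_sym -?e // => e'; rewrite e' eqxx in a'b.
  subst a2 b2; apply: (remnant [set z in [:: y; a; b; a'; b']]).
  - by apply/subsetP => z; rewrite !inE -!orbA.
  - exact: cardK.
  move=> u v; rewrite !inE => /or4P[|||/orP[]] /eqP-> h;
  [case: (Ny _ h)|case: (Na _ h)|case: (Nb _ h)|case: (a2K _ h)|case: (b2K _ h)] => ->;
  by rewrite eqxx ?orbT.
(* The cycle through y is a hexagon. *)
have [e|a2b2] := eqVneq a2 b2.
  subst b2; have Nc := two_neighbours (Hs _ _ a'a2) (Hs _ _ b'b2) a'b'.
  apply: (remnant [set z in [:: y; a; b; a'; b'; a2]]).
  - by apply/subsetP => z; rewrite !inE -!orbA => /or4P[|||/orP[]] ->; rewrite ?orbT.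
  - exact: cardK.
  move=> u v; rewrite !inE => /or4P[|||/or3P[]] /eqP-> h;
  [case: (Ny _ h)|case: (Na _ h)|case: (Nb _ h)|case: (a2K _ h)|case: (b2K _ h)|case: (Nc _ h)]
    => ->;
  by rewrite eqxx ?orbT.
(* On a longer cycle a' and b' have outer neighbours off the path, and no other vertex off the path
   is joined to both a' and b'. *)
have -> : good = nonisolated :\: [set y; a; b].
  apply/setP => v; rewrite inE andb_idr // => vS.
  have [->|va'] := eqVneq v a'.
    apply/existsP; exists a2.
    rewrite a'a2 /= !inE !negb_or a2a a2b' (eq_sym a2 a') (rel_neq a'a2) !andbT.
    apply/andP; split; apply/eqP => e; rewrite e in a'a2.
      by have := H_C3 aa' a'a2; rewrite H_sym ya.
    by case: (Nb _ (Hs _ _ a'a2)) => e'; [rewrite e' eqxx in a'b'|rewrite e' eqxx in a'y].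
  have [->|vb'] := eqVneq v b'.
    apply/existsP; exists b2.
    rewrite b'b2 /= !inE !negb_or b2b (eq_sym b2 b') (rel_neq b'b2) !andbT -andbA.
    apply/and3P; split; apply/eqP => e; rewrite e in b'b2.
    - by have := H_C3 bb' b'b2; rewrite H_sym yb.
    - by case: (Na _ (Hs _ _ b'b2)) => e'; [rewrite e' eqxx in a'b'|rewrite e' eqxx in b'y].
    - case: (a2K _ (Hs _ _ b'b2)) => e'; first by rewrite e' eqxx in b'a.
      by rewrite e' eqxx in a2b'.
  case/setDP: vS => vS; rewrite !inE !negb_or => /andP[/andP[vy va] vb].
  have ok z : H v z -> z != a' -> z != b' -> z \notin [set y; a; b; a'; b'].
    move=> vz za' zb'; rewrite !inE !negb_or za' zb' !andbT -andbA.
    apply/and3P; split; apply/eqP => e; rewrite e in vz.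
    - by case: (Ny _ (Hs _ _ vz)) => e'; [rewrite e' eqxx in va|rewrite e' eqxx in vb].
    - by case: (Na _ (Hs _ _ vz)) => e'; [rewrite e' eqxx in va'|rewrite e' eqxx in vy].
    - by case: (Nb _ (Hs _ _ vz)) => e'; [rewrite e' eqxx in vb'|rewrite e' eqxx in vy].
  have /nonisolatedP[u vu] := vS; have [w wu Nv] := H_other vu.
  have vw : H v w by rewrite Nv eqxx orbT.
  case: (boolP ((u != a') && (u != b'))) => [/andP[h1 h2]|].
    by apply/existsP; exists u; rewrite vu ok.
  case: (boolP ((w != a') && (w != b'))) => [/andP[h1 h2]|].
    by move=> _; apply/existsP; exists w; rewrite vw ok.
  rewrite !negb_and !negbK => hw hu.
  have [va2 vb2] : H v a' /\ H v b'.
    by case/orP: hu hw => /eqP eu /orP[] /eqP ew; subst; rewrite ?vu ?vw //; rewrite eqxx in wu.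
  case: (a2K _ (Hs _ _ va2)) => e; first by rewrite e eqxx in va.
  case: (b2K _ (Hs _ _ vb2)) => e'; first by rewrite e' eqxx in vb.
  by rewrite -e -e' eqxx in a2b2.
rewrite cardsD; apply: (@leq_trans (8 - 3)) => //; apply: leq_sub S8 _.
apply: leq_trans (subset_leq_card (subsetIr _ _)) _.
by rewrite setUC cardsU1 cards2; case: (b \notin _); case: (y != a).
Qed.

End GirthFive.

(** * Colourings of vertex subsets *)

(** Colours are natural numbers and [c] is total, so that restricting to a smaller set or adding the
    new colour [k] needs no change of type. *)
Definition coloring_on (G : sgraph) (A : {set G}) (k : nat) (c : G -> nat) : Prop :=
  {in A, forall z, c z < k} /\ {in A &, forall z w, adj z w -> c z <> c w}.

Lemma chi_colorable (G : sgraph) : colorable G (chi G).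
Proof. by rewrite /chi; case: ex_minnP. Qed.

Lemma chi_leq (G : sgraph) k c : coloring_on [set: G] k c -> chi G <= k.
Proof.
case=> ck cP; rewrite /chi; case: ex_minnP => m _; apply; apply/existsP.
exists [ffun z => Ordinal (ck z (in_setT z))].
apply/forallP => z; apply/forallP => w; apply/implyP => zw; rewrite !ffunE.
by apply/eqP => -[]; apply: cP; rewrite ?in_setT.
Qed.

Lemma coloring_on_induced (G : sgraph) (A : {set G}) :
  exists c, coloring_on A (chi (induced A)) c.
Proof.
have /existsP[f /forallP fP] := chi_colorable (induced A).
exists (fun z => if insub z is Some u then f u : nat else 0); split=> [z zA | z w zA wA zw].
  by rewrite (insubT (mem A) zA).
rewrite (insubT (mem A) zA) (insubT (mem A) wA) => /val_inj e.
have /forallP/(_ (Sub w wA)) := fP (Sub z zA).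
by rewrite /= /induced_adj /= zw e eqxx.
Qed.

(** * Double-critical graphs, with [k] in the role of t - 2 *)

Section DoubleCritical.
Variables (G : sgraph) (k : nat).
Hypothesis no_coloring : forall c, ~ coloring_on [set: G] k.+1 c.
Hypothesis edge_coloring : forall x y : G, adj x y ->
  exists c, coloring_on (~: [set x; y]) k c.

Definition nbrs (z : G) := [set w | adj z w].

Lemma adj_neq (z w : G) : adj z w -> z != w.
Proof. by apply: contraTneq => ->; rewrite adj_irrefl. Qed.

(** * Recolouring arguments for an edge xy *)

Section Kempe.
Variables (x y : G) (c : G -> nat).
Hypothesis xy : adj x y.
Hypothesis cP : coloring_on (~: [set x; y]) k c.

Lemma edge_coloring_lt z : z != x -> z != y -> c z < k.
Proof. by move=> zx zy; apply: (proj1 cP); rewrite !inE negb_or zx. Qed.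

Lemma edge_coloring_neq z w :
  z != x -> z != y -> w != x -> w != y -> adj z w -> c z <> c w.
Proof. by move=> zx zy wx wy; apply: (proj2 cP); rewrite !inE negb_or ?zx ?wx. Qed.

(** By symmetry a recolouring need only be checked on edges directed from an earlier stage to a
    later or equal one. *)
Lemma ranked_neq (r f : G -> nat) :
  (forall z w, adj z w -> r z <= r w -> f z <> f w) -> forall z w, adj z w -> f z <> f w.
Proof.
move=> h z w zw; case: (leqP (r z) (r w)) => [|/ltnW]; first exact: h.
by move=> le /esym; apply: h; rewrite // adj_sym.
Qed.

(* Otherwise x takes colour i, and the neighbours of x of colour i join y in a new class. *)
Lemma Kempe_triangle i : i < k -> exists z, [/\ adj x z, adj y z & c z = i].
Proof.
move=> ik; case: (boolP [exists z, [&& adj x z, adj y z & c z == i]]).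
  by case/existsP => z /and3P[xz yz /eqP cz]; exists z.
move/existsPn => none; exfalso.
pose moved z := (c z == i) && adj x z.
pose stage z := if z == x then 0 else if z == y then 1 else if moved z then 2 else 3.
(* The default of [nth] keeps the old colour in the last stage; [k] is the one new colour. *)
pose c' z := nth (c z) [:: i; k; k] (stage z).
apply: (no_coloring (c := c')).
split=> [z _|z w _ _].
  rewrite /c' /stage; case: eqVneq => [_|zx] /=; first lia.
  case: eqVneq => [_|zy] /=; first lia.
  by have := edge_coloring_lt zx zy; case: (moved z) => /=; lia.
move: z w; apply: (ranked_neq (r := stage)) => z w zw; rewrite /c' /stage.
case: (eqVneq z x) => [e|zx].
  subst z; case: (eqVneq w x) => [e|wx]; first by rewrite e adj_irrefl in zw.
  case: (eqVneq w y) => [_|wy] /=; first lia.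
  rewrite /moved zw andbT; case: eqP => /=; lia.
case: (eqVneq z y) => [e|zy].
  subst z; case: (eqVneq w x) => //= wx.
  case: (eqVneq w y) => [e|wy]; first by rewrite e adj_irrefl in zw.
  have := none w; have := edge_coloring_lt wx wy.
  by rewrite /moved zw /= andbC; case: ifP => //= _; lia.
case: (eqVneq w x) => [_|wx]; first by case: ifP.
case: (eqVneq w y) => [_|wy]; first by case: ifP.
have zw_neq := edge_coloring_neq zx zy wx wy zw; have wk := edge_coloring_lt wx wy.
case mz: (moved z); case mw: (moved w) => //= _; last by lia.
by case/andP: mz => /eqP cz _; case/andP: mw => /eqP cw _; case: zw_neq; rewrite cz cw.
Qed.

(* Otherwise x takes colour i, its neighbours of colour i take colour j, and their neighbours
   of colour j join y in a new class. *)
Lemma Kempe_path i j : i < k -> j < k -> i != j ->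
  exists z w, [/\ adj x z, adj z w, adj w y, c z = i & c w = j] /\ [/\ z != y & w != x].
Proof.
move=> ik jk ij.
pose first_ z := [&& c z == i, adj x z & z != y].
pose second_ w := [&& c w == j, w != x & [exists z, first_ z && adj z w]].
case: (boolP [exists w, second_ w && adj w y]).
  case/existsP => w /andP[/and3P[/eqP cw wx /existsP[z /andP[/and3P[/eqP cz xz zy] zw]]] wy].
  by exists z, w.
move/existsPn => none; exfalso.
pose stage z := if z == x then 0 else if z == y then 1
  else if first_ z then 2 else if second_ z then 3 else 4.
(* Again the last stage falls through to the old colour. *)
pose c' z := nth (c z) [:: i; k; j; k] (stage z).
apply: (no_coloring (c := c')).
split=> [z _|z w _ _].
  rewrite /c' /stage; case: eqVneq => [_|zx] /=; first lia.
  case: eqVneq => [_|zy] /=; first lia.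
  by have := edge_coloring_lt zx zy; case: (first_ z); case: (second_ z) => /=; lia.
move: z w; apply: (ranked_neq (r := stage)) => z w zw; rewrite /c' /stage.
case: (eqVneq z x) => [e|zx].
  subst z; case: (eqVneq w x) => [e|wx]; first by rewrite e adj_irrefl in zw.
  case: (eqVneq w y) => [_|wy] /=; first lia.
  case f: (first_ w) => /=; first by move=> _; apply/eqP.
  case: (second_ w) => /= _; first lia.
  by move=> e; rewrite /first_ -e eqxx zw wy in f.
case: (eqVneq z y) => [e|zy].
  subst z; case: (eqVneq w x) => //= wx.
  case: (eqVneq w y) => [e|wy]; first by rewrite e adj_irrefl in zw.
  case: (first_ w) => /= _; first lia.
  case s: (second_ w) => /=; first by have := none w; rewrite s adj_sym zw.
  by have := edge_coloring_lt wx wy; lia.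
case: (eqVneq w x) => [_|wx]; first by do !case: ifP.
case: (eqVneq w y) => [_|wy]; first by do !case: ifP.
have zw_neq := edge_coloring_neq zx zy wx wy zw; have wk := edge_coloring_lt wx wy.
case fz: (first_ z).
  case fw: (first_ w); first by case: zw_neq; case/and3P: fz => /eqP-> _ _;
    case/and3P: fw => /eqP->.
  case s: (second_ w) => /= _; first lia.
  move=> e; move: s; rewrite /second_ -e eqxx wx /= => /existsPn/(_ z).
  by rewrite fz zw.
case: (first_ w); first by case: ifP.
case sz: (second_ z); case sw: (second_ w) => //= _; last by lia.
by case/and3P: sz => /eqP cz _ _; case/and3P: sw => /eqP cw _ _; case: zw_neq; rewrite cz cw.
Qed.

(** The path from x to y with colours those of w and v must start with w. Its next vertex e has the
    colour of v; were e adjacent to x, it would be v, which is not adjacent to w. So e is a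
    neighbour of y outside N[x], and distinct v give distinct colours. The strict inequality counts
    x itself. *)
Lemma degree_geq (D : {set G}) : D \subset nbrs x :&: nbrs y ->
  {in D, forall v, {in nbrs x :&: nbrs y, forall e, c e = c v -> e = v} /\
    exists w, [/\ adj x w, w != y, w != v, ~~ adj w v &
      forall z, adj x z -> z != y -> c z = c w -> z = w]} ->
  #|nbrs x :&: nbrs y| + #|D| < deg y.
Proof.
move=> /subsetP DS DP.
pose E := (nbrs y :\: nbrs x) :\ x.
have ext v : v \in D -> exists2 e, e \in E & c e = c v.
  move=> vD; have [vu [w [xw wy wv nwv wu]]] := DP v vD.
  have := DS v vD; rewrite !inE => /andP[xv yv].
  have nx u : adj x u -> u != x by rewrite eq_sym; apply: adj_neq.
  have vy : v != y by rewrite eq_sym adj_neq.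
  have cwv : c w != c v by apply: contraNneq wv => /esym e; rewrite (wu v xv vy e).
  have [w' [e [[xw' w'e ey cw' ce] [w'y ex]]]] :=
    Kempe_path (edge_coloring_lt (nx _ xw) wy) (edge_coloring_lt (nx _ xv) vy) cwv.
  rewrite (wu w' xw' w'y cw') in w'e.
  exists e; rewrite // !inE ex (adj_sym y) ey andbT; apply/negP => xe.
  case/negP: nwv; rewrite -(vu e _ ce) //.
  by rewrite !inE xe adj_sym.
pose g v := odflt v [pick e in E | c e == c v].
have gP v : v \in D -> g v \in E /\ c (g v) = c v.
  move=> vD; rewrite /g; case: pickP => [e /andP[eE /eqP ce] //|none].
  by have [e eE ce] := ext v vD; have := none e; rewrite eE ce eqxx.
have g_inj : {in D &, injective g}.
  move=> u v uD vD e; have [uu _] := DP u uD; symmetry; apply: uu; first exact: DS.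
  by rewrite -(gP v vD).2 -(gP u uD).2 e.
have DE : #|D| <= #|E|.
  rewrite -(card_in_imset g_inj); apply/subset_leq_card/subsetP => _ /imsetP[v vD ->].
  by case: (gP v vD).
have xE : x \in nbrs y :\: nbrs x by rewrite !inE adj_irrefl adj_sym.
rewrite /deg -/(nbrs y) -(cardsID (nbrs x) (nbrs y)) (cardsD1 x (_ :\: _)) xE setIC.
by rewrite -/E; lia.
Qed.

End Kempe.

(** * The complement of the neighbourhood of a vertex of degree t + 1 *)

Section LowDegree.
Variable x : G.
Hypothesis deg_x : deg x = k.+3.

(** This is H, extended to all of [G] with the vertices outside N(x) isolated. *)
Definition nonadj : rel G := fun u v => [&& adj x u, adj x v, u != v & ~~ adj u v].

Lemma nonadj_sym : symmetric nonadj.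
Proof. by move=> u v; rewrite /nonadj andbCA eq_sym (adj_sym u v). Qed.

Lemma nonadj_irr : irreflexive nonadj.
Proof. by move=> u; rewrite /nonadj eqxx !andbF. Qed.

Lemma colors_common y c i : adj x y -> coloring_on (~: [set x; y]) k c -> i < k ->
  exists2 z, z \in nbrs x :&: nbrs y & c z = i.
Proof.
move=> xy cP ik; have [z [xz yz cz]] := Kempe_triangle xy cP ik.
by exists z; rewrite // !inE xz.
Qed.

Lemma common_lt y c : adj x y -> coloring_on (~: [set x; y]) k c ->
  {in nbrs x :&: nbrs y, forall z, c z < k}.
Proof.
move=> xy cP z; rewrite !inE => /andP[xz yz].
by apply: (edge_coloring_lt cP); rewrite eq_sym adj_neq.
Qed.

Lemma card_common_nonadj y : adj x y ->
  #|nbrs x :&: nbrs y| + #|[set z | nonadj y z]| = k.+2.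
Proof.
move=> xy; have yx : y \in nbrs x by rewrite inE.
move: deg_x; rewrite /deg -/(nbrs x) -(cardsID (nbrs y) (nbrs x)).
rewrite [#|_ :\: _|](cardsD1 y) !inE adj_irrefl xy /=.
suff -> : (nbrs x :\: nbrs y) :\ y = [set z | nonadj y z] by lia.
apply/setP => z; rewrite !inE /nonadj xy (eq_sym z).
by case: (adj x z); case: (y == z); case: (adj y z).
Qed.

(* w is the common neighbour of u and x with the colour of v in a colouring of G - x - u. *)
Lemma nonadj_other u v : nonadj v u ->
  exists2 w, adj u w & forall z, nonadj v z = (z == u) || (z == w).
Proof.
case/and4P=> xv xu vu nvu; have [c cP] := edge_coloring xu.
have vx : v != x by rewrite eq_sym adj_neq.
have [w [xw uw cw]] := Kempe_triangle xu cP (edge_coloring_lt cP vx vu).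
have wv : w != v by apply: contraNneq nvu => <-; rewrite adj_sym.
have vw : nonadj v w.
  rewrite /nonadj xv xw eq_sym wv /=; apply/negP => avw.
  by apply: (edge_coloring_neq cP _ _ _ _ avw); rewrite // eq_sym adj_neq.
exists w => // z.
have [c' cP'] := edge_coloring xv.
have uw_sub : [set u; w] \subset [set z | nonadj v z].
  by apply/subsetP => a; rewrite !inE => /orP[] /eqP-> //; apply/and4P.
(* All k colours occur among the common neighbours of x and v, which leaves v at most two
   H-neighbours. *)
have k2 := shared_leq (common_lt xv cP') (fun i => @colors_common v c' i xv cP').
have /eqP e : [set u; w] == [set z | nonadj v z].
  rewrite eqEcard uw_sub cards2 (adj_neq uw).
  by move: (card_common_nonadj xv) k2; clear; lia.
by have := in_set2 z u w; rewrite e inE.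
Qed.

(** The two H-neighbours of b are adjacent in [G]. *)
Lemma nonadj_C3 a b d : nonadj a b -> nonadj b d -> ~~ nonadj a d.
Proof.
rewrite nonadj_sym => ba; have [w aw Nb] := nonadj_other ba.
by rewrite Nb => /orP[] /eqP->; rewrite ?nonadj_irr // /nonadj aw !andbF.
Qed.

(** The common neighbour of x and y with the colour of a cannot be adjacent to a, nor equal to it,
    so it is the H-neighbour of a other than y. *)
Lemma color_nonadj y c a : adj x y -> coloring_on (~: [set x; y]) k c -> nonadj y a ->
  exists a', [/\ nonadj a a', a' != y & c a' = c a].
Proof.
move=> xy cP /and4P[_ xa ya nya]; rewrite eq_sym in ya.
have ax : a != x by rewrite eq_sym adj_neq.
have [z [xz yz cz]] := Kempe_triangle xy cP (edge_coloring_lt cP ax ya).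
have zy : z != y by rewrite eq_sym adj_neq.
exists z; split=> //; rewrite /nonadj xa xz /=; apply/andP; split.
  by apply: contraNneq nya => ->.
apply/negP => az; have /esym := cz; apply: (edge_coloring_neq cP) => //.
by rewrite eq_sym adj_neq.
Qed.

(** Otherwise, in a colouring of G - x - a, both b and e have the colour of d, so they are
    nonadjacent and a, b, e form a triangle of H. *)
Lemma nonadj_C4 a b d e : nonadj a b -> nonadj b d -> nonadj d e -> nonadj e a ->
  a = d \/ b = e.
Proof.
move=> ab bd de ea; have [->|ad] := eqVneq a d; first by left.
have [->|be] := eqVneq b e; first by right.
have /and4P[xa xb nab _] := ab; have /and4P[xe _ nea _] := ea.
have [c cP] := edge_coloring xa.
have col u : nonadj a u -> nonadj u d -> c u = c d.
  move=> au ud; have [u' [uu' u'a <-]] := color_nonadj xa cP au.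
  have ua : nonadj u a by rewrite nonadj_sym.
  have [w _ Nu] := nonadj_other ua.
  move: uu' ud; rewrite !Nu (negPf u'a) (eq_sym d) (negPf ad) /= => /eqP-> /eqP->.
  by [].
have cbe : c b = c e by rewrite !col // nonadj_sym.
have : nonadj b e.
  rewrite /nonadj xb xe be /=; apply/negP => abe.
  have nx u : adj x u -> u != x by rewrite eq_sym; apply: adj_neq.
  by apply: (edge_coloring_neq cP (nx b xb) _ (nx e xe) nea abe cbe); rewrite eq_sym.
by move=> be'; have := nonadj_C3 ea ab; rewrite nonadj_sym be'.
Qed.

Lemma nonadj_neq_other u v : nonadj v u ->
  exists2 w, w != u & forall z, nonadj v z = (z == u) || (z == w).
Proof.
by move=> vu; have [w uw Nv] := nonadj_other vu; exists w; rewrite // eq_sym adj_neq.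
Qed.

Lemma same_color_nonadj (A : {set G}) c : coloring_on A k c -> A \subset x |: nbrs x ->
  {in A &, forall u v, c u = c v -> u != v -> nonadj u v}.
Proof.
move=> [_ cP] /subsetP AN u v uA vA cuv uv.
have nuv : ~~ adj u v by apply/negP => /(cP _ _ uA vA).
have := AN u uA; rewrite !inE => /orP[/eqP eu|xu]; have := AN v vA; rewrite !inE.
  by case/orP=> [/eqP ev|xv]; [rewrite eu ev eqxx in uv|rewrite eu xv in nuv].
case/orP=> [/eqP ev|xv]; first by rewrite ev adj_sym xu in nuv.
by rewrite /nonadj xu xv uv.
Qed.

(** Equally coloured vertices of N[x] are joined in H, and H has no triangle, so no colour occurs
    three times. *)
Lemma card_shared_geq (B : {set G}) c : coloring_on B k c -> B \subset x |: nbrs x ->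
  #|B| * 2 <= k * 2 + #|shared c B|.
Proof.
move=> cP BN; have rel := same_color_nonadj cP BN.
apply: shared_geq => [|u v w uB vB wB cuv cvw]; first exact: (proj1 cP).
have [->|uv] := eqVneq u v; first by constructor 1.
have [->|vw] := eqVneq v w; first by constructor 2.
have [->|uw] := eqVneq u w; first by constructor 3.
have := nonadj_C3 (rel u v uB vB cuv uv) (rel v w vB wB cvw vw).
by rewrite rel // cuv.
Qed.

Lemma coloring_onS (A B : {set G}) c : B \subset A -> coloring_on A k c -> coloring_on B k c.
Proof.
move=> /subsetP BA [ck cP]; split=> [z /BA|z w /BA zA /BA wA]; first exact: ck.
exact: cP.
Qed.

Lemma nonadj_neq u v : nonadj u v -> u != v.
Proof. by case/and4P. Qed.

Lemma nonadj_nonisolated u v : nonadj u v -> u \in nonisolated nonadj.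
Proof. by move=> uv; apply/nonisolatedP; exists v. Qed.

Lemma card_nonisolated_geq (B : {set G}) c : coloring_on B k c -> B \subset x |: nbrs x ->
  #|B| * 2 <= k * 2 + #|nonisolated nonadj|.
Proof.
move=> cP BN; apply: leq_trans (card_shared_geq cP BN) _.
rewrite leq_add2l; apply/subset_leq_card/subsetP => b /sharedP[bB [b' b'B [b'b cb]]].
by apply: (@nonadj_nonisolated b b'); apply: (same_color_nonadj cP BN) => //; rewrite eq_sym.
Qed.

(** For a neighbour y of x, the k + 2 vertices of N(x) - y receive only k colours. *)
Lemma exists_nonadj : exists v a, nonadj v a.
Proof.
have /card_gt0P[y] : 0 < #|nbrs x| by rewrite [#|_|]deg_x.
rewrite inE => xy; have [c cP] := edge_coloring xy.
suff /card_gt0P[v /nonisolatedP[a va]] : 0 < #|nonisolated nonadj| by exists v, a.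
have BA : nbrs x :\ y \subset ~: [set x; y].
  apply/subsetP => z; rewrite !inE => /andP[zy xz].
  by rewrite negb_or zy andbT eq_sym adj_neq.
have BN : nbrs x :\ y \subset x |: nbrs x by rewrite (subset_trans (subD1set _ _)) ?subsetUr.
have := card_nonisolated_geq (coloring_onS BA cP) BN.
by have := deg_x; rewrite /deg -/(nbrs x) (cardsD1 y) inE xy; lia.
Qed.

(* If v is nonadjacent to the two adjacent vertices a and b, then v keeps a private colour in
   any k-colouring of G - a - b, which nevertheless repeats two colours on N[x]. *)
Lemma exists_matching : exists (p p' q q' v a : G),
  [/\ nonadj p p', nonadj q q', nonadj v a & uniq [:: p; p'; q; q'; v; a]].
Proof.
have [v [a va]] := exists_nonadj.
have [b ab Nv] := nonadj_other va; have [c cP'] := edge_coloring ab.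
have vb : nonadj v b by rewrite Nv eqxx orbT.
have /and4P[_ xa _ _] := va; have /and4P[_ xb _ _] := vb.
pose B := (x |: nbrs x) :\: [set a; b].
have BA : B \subset ~: [set a; b] by apply/subsetP => z; rewrite !inE => /andP[].
have BN : B \subset x |: nbrs x by apply: subsetDl.
have cP := coloring_onS BA cP'; have rel := same_color_nonadj cP BN.
have le := card_shared_geq cP BN.
have abN : [set a; b] \subset x |: nbrs x.
  by apply/subsetP => z; rewrite !inE => /orP[] /eqP->; rewrite ?xa ?xb orbT.
have B2 : #|B| = k.+2.
  rewrite cardsD (setIidPr abN) cards2 (adj_neq ab).
  by rewrite cardsU1 inE adj_irrefl [#|nbrs x|]deg_x; lia.
(* k + 2 vertices share k colours, none used three times. *)
have P4 : 3 < #|shared c B| by lia.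
have /card_gt0P[p /sharedP[pB [p' p'B [p'p cp]]]] : 0 < #|shared c B| by apply: leq_trans P4.
have /card_gt0P[q] : 0 < #|shared c B :\: [set p; p']|.
  rewrite cardsD subn_gt0; apply: leq_trans P4; rewrite ltnS.
  apply: leq_trans (subset_leq_card (subsetIr _ _)) _; rewrite cards2; by case: (p != p').
case/setDP=> /sharedP[qB [q' q'B [q'q cq]]]; rewrite !inE negb_or => /andP[qp qp'].
have pp' : nonadj p p' by apply: rel; rewrite // eq_sym.
have qq' : nonadj q q' by apply: rel; rewrite // eq_sym.
have cqp : c q != c p.
  apply/eqP => e; have := nonadj_C3 (rel q p qB pB e qp) pp'.
  by rewrite rel // e cp.
have notB u : u \in B -> (u != a) * (u != b) by rewrite !inE negb_or => /andP[/andP[-> ->]].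
(* The only H-neighbours of v are a and b, which are removed, so v lies in neither matched pair. *)
have nv u : nonadj v u -> u \notin B.
  by rewrite Nv => /orP[] /eqP->; rewrite !inE eqxx ?orbT.
have vneq u u' : nonadj u u' -> u' \in B -> u != v.
  by move=> uu'; apply: contraTneq => e; apply: nv; rewrite -e.
exists p, p', q, q', v, a; split=> //.
have neqc u w : c u != c w -> u != w by apply: contraNneq => ->.
rewrite /= !inE !negb_or (nonadj_neq va) (nonadj_neq pp') (nonadj_neq qq').
rewrite (vneq _ _ pp' p'B) (vneq p' p) 1?nonadj_sym //
  (vneq _ _ qq' q'B) (vneq q' q) 1?nonadj_sym //.
rewrite (notB _ pB) (notB _ p'B) (notB _ qB) (notB _ q'B).
by rewrite !neqc // ?cp ?cq // eq_sym.
Qed.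

(* If at most seven vertices of N(x) are nonisolated then every edge meets N[x], so that the
   complement of N(x) is a colour class, and three matched pairs of nonadjacent neighbours of x
   save the remaining colours. *)
Lemma card_nonisolated_geq8 : 8 <= #|nonisolated nonadj|.
Proof.
rewrite leqNgt; apply/negP => T7.
(* If the edge uv missed N[x], the k + 4 vertices of N[x] would receive k colours, forcing eight
   nonisolated vertices. *)
have out u v : ~~ adj x u -> ~~ adj x v -> u != x -> v != x -> ~~ adj u v.
  move=> xu xv ux vx; apply/negP => uv; have [c cP] := edge_coloring uv.
  have BA : x |: nbrs x \subset ~: [set u; v].
    apply/subsetP => z; rewrite !inE negb_or => /orP[/eqP->|xz]; first by rewrite !(eq_sym x) ux.
    by apply/andP; split; [apply: contraNneq xu => <-|apply: contraNneq xv => <-].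
  have := card_nonisolated_geq (coloring_onS BA cP) (subxx _).
  by rewrite cardsU1 inE adj_irrefl [#|nbrs x|]deg_x; lia.
have [p [p' [q [q' [v [a [pp' qq' va]]]]]]] := exists_matching.
rewrite /= !inE !negb_or -!andbA => /and5P[_ pq pq' pv /and5P[pa p'q p'q' p'v /and5P[p'a _ qv qa]]].
case/and4P=> q'v q'a _ _.
have [/and4P[xp xp' np _] /and4P[xq xq' nq _] /and4P[xv xa nv _]] := And3 pp' qq' va.
(* One representative for each matched pair and each other neighbour of x: k + 3 - 3 colours. *)
pose R := nbrs x :\ p' :\ q' :\ a.
pose rep z := if z == p' then p else if z == q' then q else if z == a then v else z.
have inR u : adj x u -> u != a -> u != q' -> u != p' -> u \in R.
  by rewrite !inE => -> -> -> ->.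
have repR z : adj x z -> rep z \in R.
  move=> xz; rewrite /rep; case: eqVneq => [_|zp']; first exact: inR.
  case: eqVneq => [_|zq']; first by apply: inR; rewrite // eq_sym.
  by case: eqVneq => [_|za]; apply: inR; rewrite // eq_sym.
have rep_inj z w : rep z = rep w -> [\/ z = w, nonadj z w | nonadj w z].
  have repE u : [\/ rep u = u, rep u = p /\ u = p', rep u = q /\ u = q' | rep u = v /\ u = a].
    rewrite /rep; case: eqP => [->|_]; first by constructor 2.
    case: eqP => [->|_]; first by constructor 3.
    by case: eqP => [->|_]; [constructor 4|constructor 1].
  case: (repE z) => [-> | [-> ->] | [-> ->] | [-> ->]];
  case: (repE w) => [-> | [-> ->] | [-> ->] | [-> ->]] e;
  by [subst; constructor | rewrite e eqxx in pq pv qv | case/eqP: pq | case/eqP: pv | case/eqP: qv].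
have cardR : #|R| = k.
  have := deg_x; rewrite /deg -/(nbrs x) (cardsD1 p') (cardsD1 q') (cardsD1 a) !inE.
  by rewrite xp' xq' xa (eq_sym q') p'q' (eq_sym a p') p'a (eq_sym a) q'a /= -/R !add1n => -[].
(* Colour 0 is kept for x and all its non-neighbours. *)
pose c z := if adj x z then (index (rep z) (enum R)).+1 else 0.
apply: (no_coloring (c := c)); split=> [z _|z w _ _ zw]; rewrite /c.
  case: ifP => // xz; rewrite ltnS -cardR cardE index_mem mem_enum.
  exact: repR.
case: ifP => xz; case: ifP => xw //.
  move=> [e]; have : rep z = rep w.
    by rewrite -(nth_index x (s := enum R) (x := rep z)) ?mem_enum ?repR //
      e nth_index ?mem_enum ?repR.
  case/rep_inj => [ezw|/and4P[_ _ _]|/and4P[_ _ _]].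
  - by rewrite ezw adj_irrefl in zw.
  - by rewrite zw.
  - by rewrite adj_sym zw.
have zx : z != x by apply: contraFneq xw => <-.
have wx : w != x by apply: contraFneq xz => <-; rewrite adj_sym.
by have := out z w (negbT xz) (negbT xw) zx wx; rewrite zw.
Qed.

Lemma neighbour_degree y : adj x y -> k + 6 <= deg y.
Proof.
move=> xy; have [c cP] := edge_coloring xy.
have lt := common_lt xy cP.
have leK := shared_leq lt (fun i => @colors_common y c i xy cP).
have cardN := card_common_nonadj xy.
have T8 := card_nonisolated_geq8.
(* First case: y lies on a cycle of H, giving k + 5 < deg y. *)
case: (boolP (y \in nonisolated nonadj)) => [/nonisolatedP[a ya]|yT].
  have [b ab Ny] := nonadj_other ya.
  have yb : nonadj y b by rewrite Ny eqxx orbT.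
  have [a' [aa' a'y ca']] := color_nonadj xy cP ya.
  have [b' [bb' b'y cb']] := color_nonadj xy cP yb.
  have := nonisolated_neighbour_off_path nonadj_sym nonadj_irr nonadj_neq_other nonadj_C3 nonadj_C4
    ya yb (adj_neq ab) aa' a'y bb' b'y T8.
  set D := [set u in _ | _] => D5.
  have ab2 : [set z | nonadj y z] = [set a; b] by apply/setP => z; rewrite !inE Ny.
  rewrite ab2 cards2 (adj_neq ab) in cardN.
  have cN : #|nbrs x :&: nbrs y| = k by lia.
  (* Exactly k common neighbours carry all k colours, so none repeats. *)
  have sh0 : shared c (nbrs x :&: nbrs y) = set0 by apply/eqP; rewrite -cards_eq0; lia.
  have uniqN : {in nbrs x :&: nbrs y &, forall u w, c w = c u -> w = u}.
    by move=> u w uN wN; apply: (notin_shared uN wN); rewrite sh0 inE.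
  have inN z : adj x z -> z != y -> z != a -> z != b -> z \in nbrs x :&: nbrs y.
    move=> xz zy za zb; rewrite !inE xz /=; apply: contraT => nyz.
    by have := Ny z; rewrite /nonadj xy xz eq_sym zy nyz (negPf za) (negPf zb).
  have a'N : a' \in nbrs x :&: nbrs y.
    apply: inN => //; first by case/and4P: aa'.
      by rewrite eq_sym (nonadj_neq aa').
    by apply: contraTneq aa' => ->; rewrite /nonadj ab !andbF.
  have b'N : b' \in nbrs x :&: nbrs y.
    apply: inN => //; first by case/and4P: bb'.
      by apply: contraTneq bb' => ->; rewrite /nonadj (adj_sym b) ab !andbF.
    by rewrite eq_sym (nonadj_neq bb').
  have DN : D \subset nbrs x :&: nbrs y.
    apply/subsetP => v; rewrite inE => /andP[/setDP[/nonisolatedP[w /and4P[xv _ _ _]]]].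
    by rewrite !inE !negb_or => /andP[/andP[vy va] vb] _; have := inN v xv vy va vb; rewrite !inE.
  apply: leq_trans (degree_geq xy cP DN _); first by rewrite cN -addnS leq_add2l.
  move=> v vD; have vN := subsetP DN v vD; split; first by move=> e eN; apply: uniqN.
  move: vD; rewrite inE => /andP[_ /existsP[w /andP[/and4P[xv xw vw nvw]]]].
  rewrite !inE !negb_or -!andbA => /and5P[wy wa wb wa' wb'].
  have wN := inN w xw wy wa wb.
  exists w; split; rewrite // 1?eq_sym // 1?adj_sym // => z xz zy cwz.
  (* N(x) - y has only a and b besides the common neighbours; their colours are those of a' and b',
     which w avoids. *)
  have [za|za] := eqVneq z a.
    by case/eqP: wa'; apply: uniqN; rewrite // ca' -za.
  have [zb|zb] := eqVneq z b.
    by case/eqP: wb'; apply: uniqN; rewrite // cb' -zb.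
  by apply: uniqN; rewrite ?inN.
(* Second case: y is isolated in H, so all k + 2 vertices of N(x) - y are common neighbours; at most
   four of them share a colour. This gives k + 2 + 3 < deg y. *)
set P := shared c _ in leK.
have N0 : [set z | nonadj y z] = set0.
  by apply/setP => z; rewrite !inE; apply: contraNF yT => /nonadj_nonisolated.
rewrite N0 cards0 in cardN.
have inN z : adj x z -> z != y -> z \in nbrs x :&: nbrs y.
  move=> xz zy; rewrite !inE xz /=; apply: contraNT yT => nyz.
  by apply: (@nonadj_nonisolated y z); rewrite /nonadj xy xz eq_sym zy.
have NA : nbrs x :&: nbrs y \subset ~: [set x; y].
  by apply/subsetP => z; rewrite !inE negb_or => /andP[xz yz]; rewrite !(eq_sym z) !adj_neq.
have NN : nbrs x :&: nbrs y \subset x |: nbrs x by rewrite (subset_trans (subsetIl _ _)) ?subsetUr.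
have rel := same_color_nonadj (coloring_onS NA cP) NN.
have P4 : #|P| <= 4 by lia.
have pair p : p \in P -> exists2 p', p' \in P & nonadj p p'.
  case/sharedP=> pN [p' p'N [p'p cp]]; exists p'; last by apply: rel; rewrite // eq_sym.
  by apply/sharedP; split=> //; exists p; rewrite // eq_sym.
have := nonisolated_neighbour_off nonadj_sym nonadj_irr nonadj_neq_other nonadj_C3 nonadj_C4
  P4 pair T8.
set D := [set u in _ | _] => D3.
have inT z : z \in nonisolated nonadj -> z \in nbrs x :&: nbrs y.
  move=> zT; have /nonisolatedP[w /and4P[xz _ _ _]] := zT.
  by apply: inN; rewrite //; apply: contraNneq yT => <-.
have DN : D \subset nbrs x :&: nbrs y.
  by apply/subsetP => v; rewrite inE => /andP[/setDP[/inT]].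
apply: leq_trans (degree_geq xy cP DN _).
  by rewrite -[#|_ :&: _|]addn0 cardN !addSn -!addnS leq_add2l.
move=> v; rewrite inE => /andP[/setDP[vT vP] /existsP[w /andP[vw wP]]].
have wT : w \in nonisolated nonadj by apply: (@nonadj_nonisolated w v); rewrite nonadj_sym.
have [vN wN] := (inT v vT, inT w wT).
split; first by move=> e eN; apply: (notin_shared vN eN vP).
have /and4P[xv xw nvw navw] := vw.
exists w; split=> //; [|by rewrite eq_sym|by rewrite adj_sym|].
  by apply: contraNneq yT => <-.
by move=> z xz zy cwz; apply: (notin_shared wN (inN z xz zy) wP).
Qed.

End LowDegree.
End DoubleCritical.

(** * Conclusion for double-critical graphs *)

Theorem corollary1p5 (G : sgraph) (t : nat) :
  6 <= t -> chi G = t -> double_critical G -> ~ complete G ->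
  forall x y : G, deg x = t + 1 -> adj x y ->
    ~ (deg y = t + 1 \/ deg y = t + 2 \/ deg y = t + 3).
Proof.
move=> t6 chiG [_ dc] _ x y dx xy.
have no_coloring c : ~ coloring_on [set: G] (t - 2).+1 c by move/chi_leq; lia.
have edge_coloring (u v : G) : adj u v -> exists c, coloring_on (~: [set u; v]) (t - 2) c.
  by move=> /dc e; have := coloring_on_induced (~: [set u; v]); rewrite -/(remove _) e chiG.
have dx' : deg x = (t - 2).+3 by lia.
(* With k = t - 2 the bound k + 6 is t + 4. *)
have := neighbour_degree no_coloring edge_coloring dx' xy; lia.
Qed.
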